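(* Let $k\ge2$, $v\in S_k$, $0<\theta<1$, and let $0<\kappa<1$ and $r_0\ge1$ be such that $T_{v,\zeta}$ is bounded on $\mathcal{B}_{\theta,\kappa}$ for all $|\zeta|\le r_0$. Let $z\in\mathbb{C}$ with $|z|\le1$, and let $C\ge0$ be an integer such that $\|P_C^{>}T_{v,\zeta}P_C^{>}\|_{\theta,\kappa}<1$ for all $|\zeta|\le1$ (such a $C$ exists). Define $$L_{C,z}:=P_C^{>}T_{v,z}P_C^{>},\qquad K_{C,z}:=T_{v,z}-L_{C,z}.$$ Then $K_{C,z}$ has finite rank and $L_{C,z}$ is a strict contraction on $\mathcal{B}_{\theta,\kappa}$ (operator norm $<1$). In particular $T_{v,z}$ is quasi-compact: its essential spectral radius is bounded by $\|L_{C,z}\|_{\theta,\kappa}<1$.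
   Context: Permutations are written in one-line notation; $S_n$ is the set of permutations of $\{1,\dots,n\}$ ($S_0$ contains only the empty permutation); $\sim$ denotes order-isomorphism of sequences. A permutation avoids $v\in S_k$ if no length-$k$ subsequence of it is order-isomorphic to $v$; $\mathrm{Av}(v)$ is the set of all permutations avoiding $v$. Right insertion: for $\pi\in S_n$, $r\in\{1,\dots,n+1\}$, $\mathrm{ins}(\pi,r)\in S_{n+1}$ is obtained by increasing by $1$ every value of $\pi$ that is $\ge r$ and appending the value $r$ at position $n+1$. Frontier: for $\pi\in S_n$ avoiding $v$, a $(k-1)$-partial occurrence of $v$ in $\pi$ is a tuple $i_1<\dots<i_{k-1}$ of positions with $(\pi_{i_1},\dots,\pi_{i_{k-1}})\sim(v_1,\dots,v_{k-1})$. Its forbidden rank set $J_\pi(i_1,\dots,i_{k-1})$ is the set of $r\in\{1,\dots,n+1\}$ such that $\pi'=\mathrm{ins}(\pi,r)$ satisfies $(\pi'_{i_1},\dots,\pi'_{i_{k-1}},\pi'_{n+1})\sim(v_1,\dots,v_k)$. The frontier $\mathcal{F}_v(\pi)$ is the set of all $(k-1)$-partial occurrences with nonempty forbidden rank set, and $\mathrm{Forb}_v(\pi)=\bigcup_{p\in\mathcal{F}_v(\pi)}J_\pi(p)$. State space: $\mathsf{X}_v$ is the set of pairs $x=(\pi,\mathcal{F}_v(\pi))$ with $\pi\in\mathrm{Av}(v)$; $m(x)=|\mathcal{F}_v(\pi)|$, $s(x)=|\pi|$ (length), $A_v(x)=\{1,\dots,s(x)+1\}\setminus\mathrm{Forb}_v(\pi)$,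 and for $r\in A_v(x)$, $\Phi_v(x,r)=(\pi',\mathcal{F}_v(\pi'))\in\mathsf{X}_v$ with $\pi'=\mathrm{ins}(\pi,r)$. $\mathcal{B}_{\theta,\kappa}$ is the Banach space of $f:\mathsf{X}_v\to\mathbb{C}$ with $\|f\|_{\theta,\kappa}:=\sup_{x}\theta^{-m(x)}\kappa^{-s(x)^2}|f(x)|<\infty$ (the same symbol denotes the operator norm), and $(T_{v,z}f)(x):=\sum_{r\in A_v(x)}z\,f(\Phi_v(x,r))$. For an integer $C\ge0$, $P_C$ is the projection on $\mathcal{B}_{\theta,\kappa}$ with $(P_Cf)(x)=f(x)$ if $s(x)\le C$ and $0$ otherwise, and $P_C^{>}:=I-P_C$. *)

(* Defs.v *)
From HB Require Import structures.
From mathcomp Require Import all_boot all_order all_algebra all_fingroup.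
From mathcomp Require Import complex.
From mathcomp Require Import all_classical all_reals all_analysis.

Set Implicit Arguments.
Unset Strict Implicit.
Unset Printing Implicit Defensive.

Import Order.TTheory GRing.Theory Num.Theory.
Import numFieldNormedType.Exports.

Local Open Scope ring_scope.
Local Open Scope complex_scope.

(* Positions and values of a permutation of {1, .., n} are shifted down by 1:
   they range over 'I_n = {0, .., n-1}, and the ranks {1, .., n+1} become
   'I_n.+1. *)

Section Patterns.
Local Open Scope nat_scope.

Definition oneline n (pi : 'S_n) : seq nat := [seq val (pi i) | i <- enum 'I_n].

Definition order_iso (s t : seq nat) : bool :=
  (size s == size t) &&
  [forall i : 'I_(size s), forall j : 'I_(size s),
    (nth 0 s i < nth 0 s j) == (nth 0 t i < nth 0 t j)].

Definition increasing n (p : seq 'I_n) : bool := sorted ltn (map val p).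

Definition values n (pi : 'S_n) (p : seq 'I_n) : seq nat :=
  [seq val (pi i) | i <- p].

Variables (k : nat) (v : 'S_k).

Definition avoids n (pi : 'S_n) : bool :=
  [forall p : k.-tuple 'I_n,
    increasing p ==> ~~ order_iso (values pi p) (oneline v)].

(* [lift ord_max] embeds the positions of pi into those of [ins pi r], and
   [lift r] increases by 1 the values that are at least r. *)
Definition ins n (pi : 'S_n) (r : 'I_n.+1) : 'S_n.+1 :=
  lift_perm ord_max r pi.

Definition partial_occ n (pi : 'S_n) (p : k.-1.-tuple 'I_n) : bool :=
  increasing p && order_iso (values pi p) (take k.-1 (oneline v)).

Definition forbidden n (pi : 'S_n) (p : k.-1.-tuple 'I_n) : {set 'I_n.+1} :=
  [set r | order_iso
    (values (ins pi r) (rcons (map (lift ord_max) p) ord_max)) (oneline v)].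

Definition frontier n (pi : 'S_n) : {set k.-1.-tuple 'I_n} :=
  [set p | partial_occ pi p & forbidden pi p != finset.set0].

Definition Forb n (pi : 'S_n) : {set 'I_n.+1} :=
  \bigcup_(p in frontier pi) forbidden pi p.

Lemma values_ins_lift n (pi : 'S_n) r (p : seq 'I_n) :
  values (ins pi r) (map (lift ord_max) p) = map (bump r) (values pi p).
Proof.
rewrite /values -!map_comp; apply: eq_map => i /=.
by rewrite /ins lift_perm_lift.
Qed.

Lemma order_iso_bump r (s t : seq nat) :
  order_iso (map (bump r) s) t = order_iso s t.
Proof.
rewrite /order_iso size_map; congr andb.
apply: eq_forallb => i; apply: eq_forallb => j.
by rewrite !(nth_map 0) // !ltnNge leq_bump2.
Qed.

Lemma order_iso_rcons s x t y : order_iso (rcons s x) (rcons t y) ->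
  order_iso s t.
Proof.
rewrite /order_iso !size_rcons eqSS => /andP[/eqP sz /forallP H].
rewrite sz eqxx /=; apply/forallP => i; apply/forallP => j.
have Hi : i < (size s).+1 by rewrite sz ltnW // ltnS.
have Hj : j < (size s).+1 by rewrite sz ltnW // ltnS.
have /forallP/(_ (Ordinal Hj)) := H (Ordinal Hi).
by rewrite /= !nth_rcons sz !ltn_ord.
Qed.

Lemma increasing_unlift n (p : seq 'I_n) :
  increasing (map (lift ord_max) p) = increasing p.
Proof.
rewrite /increasing -map_comp; congr sorted.
by apply: eq_map => i /=; rewrite /bump leqNgt ltn_ord.
Qed.

Lemma unlift_seq n (p : seq 'I_n.+1) : ord_max \notin p ->
  exists q : seq 'I_n, p = map (lift ord_max) q.
Proof.
elim: p => [|i p IH]; first by exists [::].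
rewrite inE negb_or => /andP[ni /IH[q ->]].
by case/unlift_some: ni => j -> _; exists (j :: q).
Qed.

Lemma increasing_rcons n (p : seq 'I_n.+1) (j : 'I_n.+1) :
  increasing (rcons p j) -> increasing p /\ ord_max \notin p.
Proof.
rewrite /increasing map_rcons -cats1 => H; split.
  by move: H; rewrite !(sorted_pairwise ltn_trans) pairwise_cat => /and3P[].
move: H; rewrite (sorted_pairwise ltn_trans) pairwise_cat => /and3P[H _ _].
apply/negP => /(map_f val) /= Hm.
move/allrelP: H => /(_ _ (val j) Hm); rewrite inE eqxx => /(_ isT) /=.
by rewrite ltnNge -ltnS ltn_ord.
Qed.

Lemma avoids_ins n (pi : 'S_n) (r : 'I_n.+1) :
  avoids pi -> r \notin Forb pi -> avoids (ins pi r).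
Proof.
move=> av nF; apply/forallP => p; apply/implyP => incp; apply/negP => isop.
have noocc (q : seq 'I_n) : size q = k -> increasing q ->
    ~~ order_iso (values pi q) (oneline v).
  move=> sq incq; have sqb : size q == k by apply/eqP.
  by have /forallP/(_ (Tuple sqb)) := av; rewrite /= incq.
have nomax : ord_max \notin tval p -> False.
  case/unlift_seq => q pq; move: incp isop; rewrite pq increasing_unlift.
  rewrite values_ins_lift order_iso_bump => incq; apply/negP/noocc => //.
  by rewrite -(size_tuple p) pq size_map.
case/lastP E: (tval p) nomax incp isop => [|p' j]; first by move/(_ isT).
have szp : (size p').+1 = k by rewrite -(size_tuple p) E size_rcons.
move=> nomax incp isop; have [incp' nmax] := increasing_rcons incp.
have jmax : j = ord_max.
  apply/eqP; apply/negPn/negP => nj; apply: nomax.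
  by rewrite mem_rcons inE negb_or eq_sym nj.
rewrite {j}jmax in nomax incp isop E.
have [q pq] := unlift_seq nmax.
have szq : size q == k.-1 by rewrite -szp pq size_map.
have szv : size (oneline v) = k by rewrite size_map size_enum_ord.
have [t [y tv]] : exists t y, oneline v = rcons t y.
  case/lastP: (oneline v) szv => [|t y _]; last by exists t, y.
  by move=> k0; rewrite -k0 in szp.
have szt : size t = k.-1 by rewrite -szv tv size_rcons.
move/negP: nF; apply; apply/bigcupP; exists (Tuple szq).
  rewrite inE; apply/andP; split; last first.
    by apply/finset.set0Pn; exists r; rewrite inE /= -pq.
  rewrite /partial_occ /= -(increasing_unlift q) -pq incp' /=.
  have -> : take k.-1 (oneline v) = t by rewrite tv -szt -cats1 take_size_cat.
  rewrite -(order_iso_bump r) -values_ins_lift -pq.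
  by apply: (@order_iso_rcons _ (val (ins pi r ord_max)) _ y);
     rewrite -tv; move: isop; rewrite /values map_rcons.
by rewrite inE /= -pq.
Qed.

End Patterns.

Section StateSpace.
Local Open Scope nat_scope.
Variables (k : nat) (v : 'S_k).

Record state := State {
  st_size : nat;
  st_perm : 'S_st_size;
  st_front : {set k.-1.-tuple 'I_st_size};
  st_avoids : avoids v st_perm;
  st_frontE : st_front == frontier v st_perm }.

Definition st_m (x : state) : nat := #|st_front x|.

Definition avail (x : state) : {set 'I_(st_size x).+1} :=
  ~: Forb v (st_perm x).

Lemma avail_avoids (x : state) r : r \in avail x ->
  avoids v (ins (st_perm x) r).
Proof. by rewrite inE; apply: avoids_ins; apply: st_avoids. Qed.

Definition Phi (x : state) (r : {r | r \in avail x}) : state :=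
  State (avail_avoids (svalP r)) (eqxx (frontier v (ins (st_perm x) (sval r)))).

End StateSpace.

(* A normed space is given by an ambient complex vector space V and an
   extended norm N on V: its elements are the f with N f < +oo. Operators are
   maps V -> V, of which only the restriction to this subspace matters. *)
Section NormedSpace.
Local Open Scope classical_set_scope.
Variables (R : realType) (V : lmodType R[i]) (N : V -> \bar R).

Definition inB : set V := [set f | (N f < +oo)%E].

Definition bounded_op (A : V -> V) : Prop :=
  (forall (a : R[i]) (f g : V), inB f -> inB g ->
     A (a *: f + g) = a *: A f + A g) /\
  exists M : R, forall f, inB f -> (N (A f) <= M%:E * N f)%E.

Definition opnorm (A : V -> V) : \bar R :=
  ereal_sup [set N (A f) | f in [set f | (N f <= 1)%E]].

Definition finite_dim (W : set V) : Prop :=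
  exists (n : nat) (g : 'I_n -> V), forall f, W f ->
    exists c : 'I_n -> R[i], f = \sum_(i < n) c i *: g i.

Definition finite_rank (A : V -> V) : Prop :=
  bounded_op A /\ finite_dim [set A f | f in inB].

Definition strict_contraction (A : V -> V) : Prop :=
  bounded_op A /\ (opnorm A < 1)%E.

Definition compact_op (A : V -> V) : Prop :=
  bounded_op A /\
  forall u : nat -> V, (forall n, (N (u n) <= 1)%E) ->
    exists phi : nat -> nat, {homo phi : m n / (m < n)%N} /\
    exists2 g, inB g &
      (fun n => N (A (u (phi n)) - g)) @ \oo --> (0%E : \bar R).

Definition quasi_compact (A : V -> V) : Prop :=
  exists (n : nat) (Q : V -> V),
    [/\ (0 < n)%N, compact_op Q
      & (opnorm (fun f => (iter n A f - Q f)%R) < 1)%E].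

(* Finite-dimensional kernel and cokernel; on a Banach space the range is then
   automatically closed. *)
Definition fredholm (A : V -> V) : Prop :=
  [/\ bounded_op A,
      finite_dim [set f | inB f /\ A f = 0]
    & exists (n : nat) (g : 'I_n -> V), (forall i, inB (g i)) /\
        forall f, inB f -> exists (u : V) (c : 'I_n -> R[i]),
          inB u /\ f = A u + \sum_(i < n) c i *: g i].

Definition ess_spectrum (A : V -> V) : set R[i] :=
  [set lambda | ~ fredholm (fun f => lambda *: f - A f)].

(* The maximum with 0 only matters when the essential spectrum is empty. *)
Definition ess_spectral_radius (A : V -> V) : \bar R :=
  maxe 0%E (ereal_sup [set (complex.Re `|lambda|)%:E | lambda in ess_spectrum A]).

End NormedSpace.

Section Transfer.
Local Open Scope classical_set_scope.
Variables (R : realType) (k : nat) (v : 'S_k).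

(* R[i]^o is R[i] seen as a vector space over itself. *)
Definition observable : lmodType R[i] := state v -> R[i]^o.

Definition wnorm (theta kappa : R) (f : observable) : \bar R :=
  ereal_sup [set (theta ^- st_m x * kappa ^- (st_size x ^ 2)%N
                  * complex.Re `|f x : R[i]|)%:E | x in [set: state v]].

Definition transfer (z : R[i]) (f : observable) : observable :=
  fun x => \sum_(r : {r | r \in avail x}) z * f (Phi r).

Definition proj_le (C : nat) (f : observable) : observable :=
  fun x => if (st_size x <= C)%N then f x else 0.

Definition proj_gt (C : nat) (f : observable) : observable := f - proj_le C f.

Definition Lop (C : nat) (z : R[i]) (f : observable) : observable :=
  proj_gt C (transfer z (proj_gt C f)).

Definition Kop (C : nat) (z : R[i]) (f : observable) : observable :=
  transfer z f - Lop C z f.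

End Transfer.

(* Main.v *)
(* Partial occurrences with a forbidden rank survive every insertion, so m never
   decreases along Phi, and |T f x| <= |z| (s+1) kappa^(2s+1) ||f|| w(x), where
   s = s(x) and w(x) = theta^m(x) kappa^(s^2). The factor tends to 0 with s,
   which gives C. The operators L and K are T restricted to outputs x with
   s(x) > C and s(x) <= C respectively, and there are finitely many of the
   latter states, so K has finite rank and, by Bolzano-Weierstrass, is compact.
   For the essential spectral radius one gets more than needed: for lambda != 0
   choose C' so large that T is bounded by |lambda|/2 on sizes > C'. Since (T f)(x)
   only involves f at size s(x) + 1, an element of ker (lambda - T) vanishes on
   sizes > C', and (lambda - T) u = f can be solved on these sizes by a
   geometric iteration. Hence lambda - T is Fredholm and the essential spectrum is
   contained in {0}. *)

Require Import Defs.
From HB Require Import structures.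
From mathcomp Require Import all_boot all_order all_algebra all_fingroup.
From mathcomp Require Import complex.
From mathcomp Require Import all_classical all_reals all_analysis.
From mathcomp Require Import zify ring lra.

Set Implicit Arguments.
Unset Strict Implicit.

Import Order.TTheory GRing.Theory Num.Theory.
Import numFieldNormedType.Exports.

Local Open Scope ring_scope.
Local Open Scope complex_scope.

(** * Insertions and the frontier; states of bounded size *)

Section Frontier.
Local Open Scope nat_scope.

(* Appending q and then a copy of r is appending r and then a copy of q: this
   transports forbidden ranks along an insertion. *)
Lemma bump_exchange (q r a : nat) :
  bump (bump (bump q r) q) (bump r a) = bump (bump q r) (bump q a).
Proof. by rewrite /bump; do !case: leqP => ? //; lia. Qed.

Variables (k : nat) (v : 'S_k).

(** The new rank is [q] if [q <= r] and [q + 1] otherwise, written with nested [lift]s to get the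
    ordinal type. After both insertions the relevant values are those for [q] alone, moved by the
    monotone map [bump (bump q r)]. *)
Lemma forbidden_ins (n : nat) (pi : 'S_n) (r q : 'I_n.+1)
    (p : k.-1.-tuple 'I_n) : q \in forbidden v pi p ->
  lift (lift (lift ord_max q) r) q
    \in forbidden v (ins pi r) (map_tuple (lift ord_max) p).
Proof.
rewrite !inE -(@order_iso_bump (bump q r)) => iso.
rewrite /values map_rcons -/(values _ _) values_ins_lift /= values_ins_lift.
move: iso; rewrite /values [X in map _ X]map_rcons -/(values _ _).
rewrite values_ins_lift map_rcons /ins !lift_perm_id /= -!map_comp.
have -> : bump n.+1 q = q by rewrite /bump leqNgt ltn_ord.
congr (order_iso (rcons _ _) _); apply: eq_map => a /=.
by rewrite bump_exchange.
Qed.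

Lemma frontier_ins (n : nat) (pi : 'S_n) (r : 'I_n.+1) (p : k.-1.-tuple 'I_n) :
  p \in frontier v pi ->
  map_tuple (lift ord_max) p \in frontier v (ins pi r).
Proof.
rewrite !inE /partial_occ /= increasing_unlift values_ins_lift order_iso_bump.
case/andP=> -> /finset.set0Pn[q q_forb].
by apply/finset.set0Pn; eexists; apply: forbidden_ins q_forb.
Qed.

Lemma leq_frontier_ins (n : nat) (pi : 'S_n) (r : 'I_n.+1) :
  #|frontier v pi| <= #|frontier v (ins pi r)|.
Proof.
pose g (p : k.-1.-tuple 'I_n) := map_tuple (lift (@ord_max n)) p.
have g_inj : injective g.
  by move=> p p' /(congr1 val)/(inj_map lift_inj) pp'; apply: val_inj.
rewrite -(card_imset _ g_inj); apply/subset_leq_card/fintype.subsetP => y.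
by case/imsetP=> p p_front ->; apply: frontier_ins.
Qed.

(** Since [theta < 1], this keeps the factor [theta ^+ st_m] from growing along [Phi]. *)
Lemma leq_st_m_Phi (x : state v) (r : {r | r \in avail x}) :
  st_m x <= st_m (Phi r).
Proof. by rewrite /st_m (eqP (st_frontE x)); apply: leq_frontier_ins. Qed.

(** The permutation determines the frontier, and the proof fields are boolean. Tagged pairs allow
    comparison before the sizes are known to agree. *)
Lemma state_eq (x y : state v) :
  Tagged (fun n => 'S_n) (st_perm x) = Tagged (fun n => 'S_n) (st_perm y) ->
  x = y.
Proof.
case: x y => [n pi F av FE] [n' pi' F' av' FE'] /= e.
have en : n = n' by case: e.
subst n'; have epi : pi = pi' by move/eqP: e; rewrite eq_Tagged => /eqP.
subst pi'; have eF : F = F' by rewrite (eqP FE) (eqP FE').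
by subst F'; rewrite (bool_irrelevance av av') (bool_irrelevance FE FE').
Qed.

Definition small_state (C : nat) : finType :=
  {p : {n : 'I_C.+1 & 'S_n} | avoids v (tagged p)}.

Definition state_of_small (C : nat) (i : small_state C) : state v :=
  @State k v _ _ _ (valP i) (eqxx _).

Lemma state_of_smallP (C : nat) (x : state v) : st_size x <= C ->
  exists i : small_state C, state_of_small i = x.
Proof.
move=> xC; pose n : 'I_C.+1 := Ordinal (xC : st_size x < C.+1).
pose p := Tagged (fun n : 'I_C.+1 => 'S_n) (st_perm x : 'S_n).
have av : avoids v (tagged p) by apply: st_avoids.
by exists (exist _ p av : small_state C); apply: state_eq.
Qed.

Lemma state_of_small_inj (C : nat) : injective (@state_of_small C).
Proof.
move=> [[n pi] av] [[n' pi'] av'].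
move/(congr1 (fun x => Tagged (fun n => 'S_n) (st_perm x))) => /= e.
apply: val_inj => /=.
have en : n = n' by apply: val_inj; case: e.
subst n'; by move/eqP: e; rewrite eq_Tagged => /eqP /= ->.
Qed.

Lemma state_of_small_size (C : nat) (i : small_state C) :
  st_size (state_of_small i) <= C.
Proof. by rewrite /= -ltnS. Qed.

End Frontier.

(** * The complex modulus as a real number *)

Section Modulus.
Variable R : realType.
Implicit Types a b c : R[i].

Definition cabs c : R := complex.Re `|c|.

Lemma normcE_cabs c : `|c| = (cabs c)%:C. Proof. by []. Qed.

Lemma cabsE c : cabs c = Normc.normc c. Proof. by []. Qed.

Lemma cabs_ge0 c : 0 <= cabs c.
Proof. by rewrite -ler0c -normcE_cabs. Qed.

Lemma cabs0 : cabs 0 = 0.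
Proof. by rewrite /cabs normr0. Qed.

Lemma cabsN c : cabs (- c) = cabs c.
Proof. by rewrite /cabs normrN. Qed.

Lemma cabsM a b : cabs (a * b) = cabs a * cabs b.
Proof. exact: Normc.normcM. Qed.

Lemma cabsV c : cabs c^-1 = (cabs c)^-1.
Proof. exact: Normc.normcV. Qed.

Lemma cabsD a b : cabs (a + b) <= cabs a + cabs b.
Proof. by rewrite -lecR rmorphD /= -!normcE_cabs ler_normD. Qed.

Lemma cabsB a b : cabs (a - b) <= cabs a + cabs b.
Proof. by rewrite -(cabsN b) cabsD. Qed.

Lemma cabs_sum (I : finType) (F : I -> R[i]) :
  cabs (\sum_i F i) <= \sum_i cabs (F i).
Proof.
elim/big_ind2: _ => [|x1 y1 x2 y2 h1 h2|//]; first by rewrite cabs0.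
by rewrite (le_trans (cabsD _ _)) ?lerD.
Qed.

Lemma cabs_eq0 c : cabs c = 0 -> c = 0.
Proof. exact: Normc.eq0_normc. Qed.

Lemma cabs_gt0 c : c != 0 -> 0 < cabs c.
Proof.
move=> c0; rewrite lt_neqAle cabs_ge0 andbT eq_sym.
by apply: contra c0 => /eqP/cabs_eq0 ->.
Qed.

Lemma cabs_le1 c : `|c| <= 1 -> cabs c <= 1.
Proof. by rewrite normcE_cabs -(lecR _ 1). Qed.

Lemma cabs_Re c : `|complex.Re c| <= cabs c.
Proof. by rewrite -lecR -normcE_cabs normc_ge_Re. Qed.

Lemma cabs_i : cabs 'i%C = 1 :> R.
Proof. by rewrite cabsE /= expr0n expr1n add0r sqrtr1. Qed.

Lemma cabs_real (r : R) : cabs r%:C = `|r|.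
Proof. by rewrite cabsE /= expr0n addr0 sqrtr_sqr. Qed.

(** Multiplication by [i] keeps the modulus and turns the imaginary part, up to sign, into a real
    part. *)
Lemma cabs_Im c : `|complex.Im c| <= cabs c.
Proof.
by have := cabs_Re (c * 'i%C); rewrite ReiNIm normrN cabsM cabs_i mulr1.
Qed.

Lemma cabs_ReIm c : cabs c <= `|complex.Re c| + `|complex.Im c|.
Proof.
rewrite {1}(complexE c) (le_trans (cabsD _ _)) //.
by rewrite cabsM cabs_i mul1r !cabs_real.
Qed.

End Modulus.

(** * Bolzano-Weierstrass and geometric convergence *)

Section Subsequences.
Variable R : realType.
Local Open Scope classical_set_scope.

Lemma bounded_subsequence_cvg (u : nat -> R) (M : R) :
  (forall n, `|u n| <= M) ->
  exists phi : nat -> nat, {homo phi : m n / (m < n)%N} /\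
    exists l : R, u \o phi @ \oo --> l.
Proof.
move=> uM.
have [|l [_ /cluster_eventually_cvg[phi phi_incr phil]]] :=
    @segment_compact R (- M) M (u @ \oo) _.
  by exists 0%N => // n _ /=; rewrite in_itv /= -ler_norml uM.
by exists phi; split; [move=> m n; rewrite -(leqW_mono phi_incr)|exists l].
Qed.

Lemma homo_ltn_geq (phi : nat -> nat) : {homo phi : m n / (m < n)%N} ->
  forall n, (n <= phi n)%N.
Proof.
by move=> phi_incr; elim=> // n IHn; apply: leq_ltn_trans IHn (phi_incr _ _ _).
Qed.

Lemma cvg_subsequence (u : nat -> R) (l : R) (phi : nat -> nat) :
  {homo phi : m n / (m < n)%N} -> u @ \oo --> l -> u \o phi @ \oo --> l.
Proof.
move=> phi_incr; apply: cvg_comp => A [N _ NA].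
exists N => // n /= Nn; apply: NA => /=.
by apply: leq_trans Nn (homo_ltn_geq phi_incr n).
Qed.

(** Indices are treated one at a time: each passes to a further subsequence, which preserves the
    limits already found. *)
Lemma bounded_subsequence_cvg_fin (I : finType) (u : I -> nat -> R) (M : R) :
  (forall i n, `|u i n| <= M) ->
  exists phi : nat -> nat, {homo phi : m n / (m < n)%N} /\
    exists l : I -> R, forall i, u i \o phi @ \oo --> l i.
Proof.
move=> uM.
suff H (s : seq I) : exists phi : nat -> nat, {homo phi : m n / (m < n)%N} /\
    exists l : I -> R, forall i, i \in s -> u i \o phi @ \oo --> l i.
  have [phi [phi_incr [l lP]]] := H (enum I).
  by exists phi; split=> //; exists l => i; apply: lP; rewrite mem_enum.
elim: s => [|i s [phi [phi_incr [l lP]]]].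
  by exists id; split=> //; exists (fun=> 0).
have [psi [psi_incr [li liP]]] :=
  bounded_subsequence_cvg (u := u i \o phi) (fun n => uM i (phi n)).
exists (phi \o psi); split; first by move=> m n /psi_incr/phi_incr.
exists (fun j => if j == i then li else l j) => j; rewrite inE.
by have [->//|_ /= /lP/(cvg_subsequence psi_incr)] := eqVneq j i.
Qed.

Lemma bounded_subsequence_cabs (I : finType) (u : I -> nat -> R[i]) (M : R) :
  (forall i n, cabs (u i n) <= M) ->
  exists phi : nat -> nat, {homo phi : m n / (m < n)%N} /\
    exists l : I -> R[i], forall e, 0 < e ->
      exists N, forall n, (N <= n)%N -> forall i, cabs (u i (phi n) - l i) <= e.
Proof.
move=> uM.
(* Doubling the index set yields one subsequence for all real and imaginary parts. *)
pose part (ib : I * bool) n :=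
  if ib.2 then complex.Re (u ib.1 n) else complex.Im (u ib.1 n).
have partM ib n : `|part ib n| <= M.
  apply: le_trans (uM ib.1 n).
  by rewrite /part; case: ifP; rewrite ?cabs_Re ?cabs_Im.
have [phi [phi_incr [l lP]]] := bounded_subsequence_cvg_fin partM.
exists phi; split=> //; exists (fun i => l (i, true) +i* l (i, false)) => e e0.
have : \forall n \near \oo, forall ib, `|l ib - (part ib \o phi) n| <= e / 2.
  apply: filter_forall => ib; move/cvgrPdist_le: (lP ib); apply.
  by rewrite divr_gt0.
case=> N _ NP; exists N => n Nn i.
rewrite (le_trans (cabs_ReIm _)) // [leRHS]splitr; apply: lerD.
- have := NP n Nn (i, true).
  by rewrite distrC /part /=; case: (u i (phi n)).
- have := NP n Nn (i, false).
  by rewrite distrC /part /=; case: (u i (phi n)).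
Qed.

Lemma half_pow_small (A e : R) : 0 < e -> exists N, A * 2^-1 ^+ N <= e.
Proof.
move=> e0; have half_lt1 : `|2^-1 : R| < 1.
  by rewrite ger0_norm ?invr_ge0 // invf_lt1 // ltr1n.
have /cvgrPdist_le/(_ _ e0)[N _ /(_ N (leqnn N))] :=
  @cvg_geometric R A _ half_lt1.
rewrite sub0r normrN /geometric /= => AN.
by exists N; rewrite (le_trans (ler_norm _)).
Qed.

Lemma le_half_pow_eq0 (a A : R) :
  0 <= a -> (forall n, a <= A * 2^-1 ^+ n) -> a = 0.
Proof.
move=> a0 aA; apply/eqP; rewrite eq_le a0 andbT; apply/ler_addgt0Pl => e e0.
have [N AN] := half_pow_small A e0.
by rewrite addr0 (le_trans (aA N)).
Qed.

(** The sequence is bounded, so a subsequence converges; the tail estimate, uniform in the later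
    index, then passes to its limit. *)
Lemma geometric_cabs_cvg (a : nat -> R[i]) (A : R) :
  (forall n, cabs (a n.+1 - a n) <= A * 2^-1 ^+ n) ->
  exists l, forall n, cabs (l - a n) <= 2 * A * 2^-1 ^+ n.
Proof.
move=> stepA.
have A0 : 0 <= A.
  by have := stepA 0%N; rewrite expr0 mulr1; apply: le_trans (cabs_ge0 _).
(* The factor [1 - 2^-1 ^+ m], from the partial geometric sum, lets the induction on [m] close. *)
have far n m : cabs (a (n + m)%N - a n) <= 2 * A * 2^-1 ^+ n * (1 - 2^-1 ^+ m).
  elim: m => [|m IHm]; first by rewrite addn0 subrr cabs0 expr0 subrr mulr0.
  rewrite addnS -(subrKA (a (n + m)%N)) (le_trans (cabsD _ _)) //.
  apply: le_trans (lerD (stepA _) IHm) _; rewrite exprD exprS.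
  set x := 2^-1 ^+ n; set y := _ ^+ m; lra.
have {}far n m : cabs (a (n + m)%N - a n) <= 2 * A * 2^-1 ^+ n.
  have half_ge0 i : 0 <= 2^-1 ^+ i :> R by rewrite exprn_ge0 ?invr_ge0.
  by apply: le_trans (far n m) _; rewrite ler_piMr ?mulr_ge0 // gerBl.
have [|phi [phi_incr [l lP]]] :=
    @bounded_subsequence_cabs unit (fun=> a) (cabs (a 0%N) + 2 * A).
  move=> _ n; have := far 0%N n; rewrite add0n expr0 mulr1 => far0.
  rewrite -(subrK (a 0%N) (a n)).
  by rewrite (le_trans (cabsD _ _)) // addrC lerD2l.
exists (l tt) => n; apply/ler_addgt0Pl => e e0.
have [N NP] := lP e e0; pose m := maxn n N.
have nm : (n <= phi m)%N.
  by apply: leq_trans (homo_ltn_geq phi_incr m); rewrite leq_maxl.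
have l_close := NP m (leq_maxr _ _) tt.
have := far n (phi m - n)%N; rewrite subnKC // => phi_far.
rewrite -(subrKA (a (phi m))) (le_trans (cabsD _ _)) // lerD //.
by rewrite -cabsN opprB.
Qed.

End Subsequences.

(** * The decay of one transfer step with the size *)

Section Decay.
Variables (R : realType) (kappa : R).
Hypothesis kappa01 : 0 < kappa < 1.

(** [s.+1] bounds the number of available ranks; the exponent is the difference of the squares of
    [s + 1] and [s]. *)
Definition decay (s : nat) : R := s.+1%:R * kappa ^+ (s.*2.+1).

Lemma decay_ge0 s : 0 <= decay s.
Proof. by case/andP: kappa01 => /ltW k0 _; rewrite mulr_ge0 ?exprn_ge0. Qed.

(** Split [2s + 1] as [(s + 1) + s]: the product of [s + 1] and [kappa ^+ s.+1] is at most a partial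
    geometric sum, and [kappa ^+ s] is left over. *)
Lemma decay_le s : decay s <= (1 - kappa)^-1 * kappa ^+ s.
Proof.
case/andP: kappa01 => k0 k1; have k1' := ltW k1.
have sum_le : s.+1%:R * kappa ^+ s.+1 <= \sum_(i < s.+1) kappa ^+ i.
  rewrite mulr_natl -[X in _ *+ X](card_ord s.+1) -sumr_const.
  by apply: ler_sum => i _; rewrite ler_wiXn2l // 1?ltW // ltnW.
have : (1 - kappa) * \sum_(i < s.+1) kappa ^+ i <= 1.
  by rewrite -opprB mulNr -subrX1 opprB gerBl exprn_ge0 // ltW.
rewrite -ler_pdivlMl ?subr_gt0 // mulr1 => sum_le'.
rewrite /decay -addnn -addSn exprD mulrA ler_pM2r ?exprn_gt0 //.
exact: le_trans sum_le sum_le'.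
Qed.

Lemma decay_bounded s : decay s <= (1 - kappa)^-1.
Proof.
case/andP: kappa01 => /ltW k0 k1; apply: le_trans (decay_le s) _.
by rewrite ler_piMr ?invr_ge0 ?subr_ge0 ?exprn_ile1 // ltW.
Qed.

Lemma decay_small (e : R) : 0 < e ->
  exists C, forall s, (C < s)%N -> decay s <= e.
Proof.
case/andP: kappa01 => k0 k1 e0.
have k_lt1 : `|kappa| < 1 by rewrite gtr0_norm.
have /cvgrPdist_le/(_ _ e0)[C _ CP] := @cvg_geometric R (1 - kappa)^-1 _ k_lt1.
exists C => s Cs; apply: le_trans (decay_le s) _.
have := CP s (ltnW Cs); rewrite sub0r normrN; apply: le_trans.
exact: ler_norm.
Qed.

End Decay.

(** * The weighted norm and estimates for the transfer operator *)

Section Weighted.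
Variables (R : realType) (k : nat) (v : 'S_k) (theta kappa : R).
Hypotheses (theta01 : 0 < theta < 1) (kappa01 : 0 < kappa < 1).

Local Notation obs := (observable R v).
Local Notation N := (@wnorm R k v theta kappa).
Implicit Types (f g : obs) (x y : state v) (C : nat) (z c : R[i]) (M : R).

Definition weight x : R := theta ^+ st_m x * kappa ^+ (st_size x ^ 2)%N.

Lemma weight_gt0 x : 0 < weight x.
Proof.
case/andP: theta01 => t0 _; case/andP: kappa01 => k0 _.
by rewrite mulr_gt0 ?exprn_gt0.
Qed.

Lemma weight_ge0 x : 0 <= weight x. Proof. exact/ltW/weight_gt0. Qed.

Definition dominated M f := forall x, cabs (f x) <= M * weight x.

Lemma weighted_leP x c M :
  (theta ^- st_m x * kappa ^- (st_size x ^ 2)%N * cabs c <= M)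
    = (cabs c <= M * weight x).
Proof. by rewrite -invfM mulrC ler_pdivrMr // weight_gt0. Qed.

(** This replaces the extended-real supremum by pointwise real inequalities, in which the later
    estimates are carried out. *)
Lemma wnorm_leP f M : (N f <= M%:E)%E <-> dominated M f.
Proof.
split=> [fM x|fM].
  rewrite -weighted_leP -lee_fin (le_trans _ fM) //.
  by apply: ereal_sup_ubound; exists x.
by apply: ge_ereal_sup => _ [x _ <-]; rewrite lee_fin weighted_leP.
Qed.

Lemma dominated_inB M f : dominated M f -> inB N f.
Proof. by move/wnorm_leP/le_lt_trans; apply; rewrite ltry. Qed.

Lemma dominatedD M M' f g : dominated M f -> dominated M' g ->
  dominated (M + M') (f + g).
Proof.
by move=> fM gM x; rewrite mulrDl (le_trans (cabsD _ _)) ?lerD.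
Qed.

Lemma dominatedN M f : dominated M f -> dominated M (- f).
Proof. by move=> fM x; rewrite cabsN. Qed.

Lemma dominatedZ M c f : dominated M f -> dominated (cabs c * M) (c *: f).
Proof. by move=> fM x; rewrite cabsM -mulrA ler_wpM2l ?cabs_ge0. Qed.

Lemma opnorm_le (A : obs -> obs) (D : R) :
  (forall f, dominated 1 f -> dominated D (A f)) -> (opnorm N A <= D%:E)%E.
Proof.
by move=> AD; apply: ge_ereal_sup => _ [f /wnorm_leP f1 <-]; apply/wnorm_leP/AD.
Qed.

Lemma obsD f g x : (f + g) x = f x + g x. Proof. by []. Qed.
Lemma obsB f g x : (f - g) x = f x - g x. Proof. by []. Qed.
Lemma obsZ c f x : (c *: f) x = c * f x :> R[i]. Proof. by []. Qed.
Definition obsE := (obsB, obsD, obsZ).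

Lemma transfer_linear z c f g :
  transfer z (c *: f + g) = c *: transfer z f + transfer z g.
Proof.
apply/funext => x; rewrite !obsE /transfer big_distrr -big_split /=.
by apply: eq_bigr => r _; rewrite !obsE mulrDr mulrCA.
Qed.

Lemma weight_Phi x (r : {r | r \in avail x}) :
  weight (Phi r) <= kappa ^+ (st_size x).*2.+1 * weight x.
Proof.
case/andP: theta01 => t0 /ltW t1; case/andP: kappa01 => k0 _.
have sizeE : ((st_size x).*2.+1 + st_size x ^ 2 = st_size (Phi r) ^ 2)%N.
  by rewrite /= !expnS !expn0; lia.
rewrite /weight mulrCA -exprD sizeE ler_wpM2r ?exprn_ge0 ?(ltW k0) //.
by rewrite ler_wiXn2l ?(ltW t0) // leq_st_m_Phi.
Qed.

Lemma transferB z f g : transfer z (f - g) = transfer z f - transfer z g.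
Proof. by rewrite addrC -scaleN1r transfer_linear scaleN1r addrC. Qed.

(** Bounding [f] only at size [s(x) + 1] makes the estimate usable both globally and on tails of
    large states. *)
Lemma transfer_le z f x M : 0 <= M ->
    (forall y, st_size y = (st_size x).+1 -> cabs (f y) <= M * weight y) ->
  cabs (transfer z f x) <= cabs z * decay kappa (st_size x) * M * weight x.
Proof.
move=> M0 fM; case/andP: (kappa01) => k0 _.
(* [t] bounds each summand; as it is nonnegative, the number of summands may be raised to
   [s(x) + 1]. *)
pose t := cabs z * (M * (kappa ^+ (st_size x).*2.+1 * weight x)).
have t0 : 0 <= t.
  apply: mulr_ge0 (cabs_ge0 _) (mulr_ge0 M0 (mulr_ge0 _ (weight_ge0 x))).
  exact: exprn_ge0 (ltW k0).
apply: le_trans (cabs_sum _) _.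
apply: (@le_trans _ _ (\sum_(r : {r | r \in avail x}) t)).
  apply: ler_sum => r _; rewrite cabsM ler_wpM2l ?cabs_ge0 //.
  by rewrite (le_trans (fM _ _)) // ler_wpM2l // weight_Phi.
rewrite sumr_const -mulr_natl.
have -> : cabs z * decay kappa (st_size x) * M * weight x =
    (st_size x).+1%:R * t.
  by rewrite /t /decay; ring.
by rewrite ler_wpM2r // ler_nat card_sig (leq_trans (max_card _)) ?card_ord.
Qed.

Lemma transfer_dominated z f M : 0 <= M -> dominated M f ->
  dominated (cabs z * (1 - kappa)^-1 * M) (transfer z f).
Proof.
move=> M0 fM x; apply: le_trans (transfer_le z M0 (fun y _ => fM y)) _.
by rewrite !ler_wpM2r ?weight_ge0 // ler_wpM2l ?cabs_ge0 ?decay_bounded.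
Qed.

(** The inner projection has no effect here: at a state of size above [C], the transfer operator
    reads [f] only at a still larger size. *)
Lemma LopE C z f x : Lop C z f x =
  if (st_size x <= C)%N then 0 else transfer z f x.
Proof.
rewrite /Lop /proj_gt obsB {2}/proj_le.
case: leqP => [xC|Cx]; first by rewrite subrr.
rewrite subr0; apply: eq_bigr => r _; congr (_ * _).
by rewrite obsB /proj_le /= leqNgt ltnW //= subr0.
Qed.

Lemma KopE C z f x : Kop C z f x =
  if (st_size x <= C)%N then transfer z f x else 0.
Proof. by rewrite /Kop obsB LopE; case: ifP => _; rewrite ?subr0 ?subrr. Qed.

(** [C] is chosen from [kappa] alone, with [decay] at most 1/2 beyond it; hence the uniformity in
    [z]. *)
Lemma Lop_contraction : exists C, forall z, cabs z <= 1 ->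
  (opnorm N (@Lop R k v C z) < 1)%E.
Proof.
have half_gt0 : 0 < 2^-1 :> R by rewrite invr_gt0.
have [C CP] := decay_small kappa01 half_gt0; exists C => z z1.
apply: (@le_lt_trans _ _ (2^-1)%:E); last by rewrite lte_fin invf_lt1 // ltr1n.
apply: opnorm_le => f f1 x; rewrite LopE; case: leqP => Cx.
  by rewrite cabs0 mulr_ge0 ?invr_ge0 ?weight_ge0.
apply: le_trans (transfer_le z ler01 (fun y _ => f1 y)) _.
rewrite mulr1 ler_wpM2r ?weight_ge0 // (le_trans _ (CP _ Cx)) //.
by rewrite ler_piMl ?decay_ge0.
Qed.

Hypothesis k_gt0 : (0 < k)%N.

Lemma empty_avoids : avoids v (1 : 'S_0)%g.
Proof.
apply/forallP => p; exfalso; move: k_gt0 p; case: k => // k' _ p.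
by case: (tnth p ord0).
Qed.

Definition empty_state : state v := State empty_avoids (eqxx _).

(** A supremum over no states would be [-oo]; [empty_state] provides a nonnegative term. *)
Lemma wnorm_ge0 f : (0 <= N f)%E.
Proof.
apply: (@le_trans _ _ (theta ^- st_m empty_state
    * kappa ^- (st_size empty_state ^ 2)%N * cabs (f empty_state))%:E).
  case/andP: theta01 => /ltW ? _; case/andP: kappa01 => /ltW ? _.
  by rewrite lee_fin !mulr_ge0 ?invr_ge0 ?exprn_ge0 ?cabs_ge0.
by apply: ereal_sup_ubound; exists empty_state.
Qed.

Lemma inB_wnorm f : inB N f ->
  exists M, [/\ 0 <= M, N f = M%:E & dominated M f].
Proof.
move=> fB; have f_fin : N f \is a fin_num by rewrite ge0_fin_numE ?wnorm_ge0.
exists (fine (N f)); rewrite fineK //; split=> //.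
  by rewrite fine_ge0 ?wnorm_ge0.
by apply/wnorm_leP; rewrite fineK.
Qed.

Lemma opnorm_ge0 (A : obs -> obs) : (0 <= opnorm N A)%E.
Proof.
apply: (le_trans (wnorm_ge0 (A 0))); apply: ereal_sup_ubound; exists 0 => //=.
by apply/wnorm_leP => x; rewrite cabs0 mul1r weight_ge0.
Qed.

Lemma bounded_op_intro (A : obs -> obs) (D : R) :
    (forall c f g, A (c *: f + g) = c *: A f + A g) ->
    (forall M f, 0 <= M -> dominated M f -> dominated (D * M) (A f)) ->
  bounded_op N A.
Proof.
move=> A_lin AD; split=> [c f g _ _|]; first exact: A_lin.
exists D => f /inB_wnorm[M [M0 -> fM]]; rewrite -EFinM.
by apply/wnorm_leP/AD.
Qed.

(** * Observables supported on small states *)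

Lemma obs_sum (I : finType) (F : I -> obs) x : (\sum_i F i) x = \sum_i F i x.
Proof. exact: (big_morph (fun f : obs => f x)). Qed.

Definition state_key x := Tagged (fun n => 'S_n) (st_perm x).

(** The indicator of [y], tested on keys because these have a decidable equality. *)
Definition delta y : obs := fun x => (state_key x == state_key y)%:R.

Lemma deltaE x y : (delta y x = 1 /\ x = y) \/ (delta y x = 0 /\ x <> y).
Proof.
rewrite /delta; case: eqVneq => [/state_eq ->|ne]; first by left.
by right; split=> // xy; rewrite xy eqxx in ne.
Qed.

Lemma delta_inB y : inB N (delta y).
Proof.
apply: (@dominated_inB (weight y)^-1) => x.
have [[-> ->]|[-> _]] := deltaE x y.
  by rewrite mulVf ?gt_eqF ?weight_gt0 // cabsE Normc.normc1.
by rewrite cabs0 mulr_ge0 ?invr_ge0 ?weight_ge0.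
Qed.

(** The sum runs over ordinals through [enum_val], to match the families in [finite_dim] and
    [fredholm]. *)
Definition small_sum C (a : small_state v C -> R[i]) : obs :=
  \sum_(i < #|small_state v C|)
    a (enum_val i) *: delta (state_of_small (enum_val i)).

Lemma small_sum_small C (a : small_state v C -> R[i]) i :
  small_sum a (state_of_small i) = a i.
Proof.
rewrite /small_sum obs_sum (bigD1 (enum_rank i)) //= big1 => [|j ji].
  rewrite addr0 obsZ enum_rankK.
  by case: (deltaE (state_of_small i) (state_of_small i)) => [[->]|[]//];
    rewrite mulr1.
rewrite obsZ; case: (deltaE (state_of_small i) (state_of_small (enum_val j))).
  by case=> _ /state_of_small_inj ij; rewrite ij enum_valK eqxx in ji.
by case=> -> _; rewrite mulr0.
Qed.

Lemma small_sum_large C (a : small_state v C -> R[i]) x : (C < st_size x)%N ->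
  small_sum a x = 0.
Proof.
move=> Cx; rewrite /small_sum obs_sum big1 // => j _; rewrite obsZ.
case: (deltaE x (state_of_small (enum_val j))) => [[_ xj]|[-> _]].
  by move: Cx; rewrite xj ltnNge state_of_small_size.
by rewrite mulr0.
Qed.

Lemma small_sumE C f : (forall x, (C < st_size x)%N -> f x = 0) ->
  f = small_sum (fun i : small_state v C => f (state_of_small i)).
Proof.
move=> f0; apply/funext => x; have [xC|Cx] := leqP (st_size x) C.
  by have [i <-] := state_of_smallP xC; rewrite small_sum_small.
by rewrite f0 ?small_sum_large.
Qed.

Lemma finite_dim_small C (W : set obs) :
  (forall f, W f -> forall x, (C < st_size x)%N -> f x = 0) -> finite_dim W.
Proof.
move=> W0; exists #|small_state v C|.
exists (fun i => delta (state_of_small (enum_val i))) => f Wf.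
by rewrite (small_sumE (W0 f Wf)); eexists.
Qed.

(** * Boundedness of [Lop] and [Kop]; finite rank and compactness of [Kop] *)

Lemma transfer_bound_ge0 z : 0 <= cabs z * (1 - kappa)^-1.
Proof.
case/andP: kappa01 => _ /ltW k1.
by rewrite mulr_ge0 ?cabs_ge0 // invr_ge0 subr_ge0.
Qed.

Lemma Lop_bounded C z : bounded_op N (@Lop R k v C z).
Proof.
apply: (@bounded_op_intro _ (cabs z * (1 - kappa)^-1)) => [c f g|M f M0 fM].
  apply/funext => x; rewrite !obsE !LopE; case: ifP => _.
    by rewrite mulr0 addr0.
  by rewrite transfer_linear !obsE.
move=> x; rewrite LopE; case: ifP => _; last exact: transfer_dominated.
by rewrite cabs0 (mulr_ge0 (mulr_ge0 (transfer_bound_ge0 z) M0)) ?weight_ge0.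
Qed.

Lemma Kop_dominated C z f M : 0 <= M -> dominated M f ->
  dominated (cabs z * (1 - kappa)^-1 * M) (Kop C z f).
Proof.
move=> M0 fM x; rewrite KopE; case: ifP => _; first exact: transfer_dominated.
by rewrite cabs0 (mulr_ge0 (mulr_ge0 (transfer_bound_ge0 z) M0)) ?weight_ge0.
Qed.

Lemma Kop_bounded C z : bounded_op N (@Kop R k v C z).
Proof.
apply: (@bounded_op_intro _ (cabs z * (1 - kappa)^-1)) => [c f g|M f].
  apply/funext => x; rewrite !obsE !KopE; case: ifP => _.
    by rewrite transfer_linear !obsE.
  by rewrite mulr0 addr0.
exact: Kop_dominated.
Qed.

Lemma Kop_finite_rank C z : finite_rank N (@Kop R k v C z).
Proof.
split; first exact: Kop_bounded.
apply: (@finite_dim_small C) => _ [f _ <-] x Cx.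
by rewrite KopE leqNgt Cx.
Qed.

(** Images under [Kop] have finitely many coordinates, at the small states, so Bolzano-Weierstrass
    applies to them. *)
Lemma Kop_compact C z : compact_op N (@Kop R k v C z).
Proof.
split=> [|u uN]; first exact: Kop_bounded.
pose D := cabs z * (1 - kappa)^-1.
have KD n : dominated D (Kop C z (u n)).
  by rewrite -[D]mulr1; apply: Kop_dominated => //; apply/wnorm_leP.
pose e (i : small_state v C) := state_of_small i.
(* Division by the weight bounds all coordinates by [D] and makes their uniform convergence
   convergence in norm; [g] below undoes the scaling. *)
pose a i n := ((weight (e i))^-1)%:C * Kop C z (u n) (e i).
have aD i n : cabs (a i n) <= D.
  rewrite cabsM cabs_real ger0_norm ?invr_ge0 ?weight_ge0 //.
  by rewrite ler_pdivrMl ?weight_gt0 // mulrC KD.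
have [phi [phi_incr [l lP]]] := bounded_subsequence_cabs aD.
exists phi; split=> //; pose g := small_sum (fun i => (weight (e i))%:C * l i).
have close eps : 0 < eps -> exists n0, forall n, (n0 <= n)%N ->
    dominated eps (Kop C z (u (phi n)) - g).
  move=> eps0; have [n0 n0P] := lP _ eps0; exists n0 => n /n0P le_eps x.
  have [xC|Cx] := leqP (st_size x) C.
    have [i <-] := state_of_smallP xC; rewrite obsB /g small_sum_small.
    have -> : Kop C z (u (phi n)) (e i) = (weight (e i))%:C * a i (phi n).
      by rewrite /a mulrA -rmorphM /= mulfV ?gt_eqF ?weight_gt0 // mul1r.
    rewrite -mulrBr cabsM cabs_real ger0_norm ?weight_ge0 // mulrC.
    by rewrite ler_wpM2r ?weight_ge0.
  rewrite obsB /g small_sum_large // KopE leqNgt Cx subrr cabs0.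
  by rewrite mulr_ge0 ?weight_ge0 ?ltW.
exists g.
  have [n0 /(_ n0 (leqnn _)) gK] := close 1 ltr01.
  (* [g] is a dominated image minus a dominated error. *)
  rewrite -[g](subKr (Kop C z (u (phi n0)))).
  by apply: dominated_inB (dominatedD (KD _) (dominatedN gK)).
apply/fine_cvgP; split.
  have [n0 n0P] := close 1 ltr01.
  exists n0 => // n /n0P /= /dominated_inB; rewrite /inB /= => fin.
  by rewrite ge0_fin_numE ?wnorm_ge0.
apply/cvgrPdist_le => eps eps0; have [n0 n0P] := close _ eps0.
exists n0 => // n /n0P /= dom.
rewrite sub0r normrN ger0_norm ?fine_ge0 ?wnorm_ge0 //.
have /inB_wnorm[M [_ eM _]] := dominated_inB dom.
by rewrite eM /= -lee_fin -eM; apply/wnorm_leP.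
Qed.

(** * The Fredholm property of [lambda - T] for nonzero [lambda] *)

Section Resolvent.
Variables (z lambda : R[i]) (C : nat).
Hypothesis lambda_neq0 : lambda != 0.
Hypothesis tail_half :
  forall s, (C < s)%N -> cabs z * decay kappa s <= cabs lambda / 2.

(** The estimate closes up on sizes above [C], since the transfer operator only looks at larger
    sizes. *)
Lemma transfer_tail f M x : 0 <= M -> (C < st_size x)%N ->
    (forall y, (C < st_size y)%N -> cabs (f y) <= M * weight y) ->
  cabs (transfer z f x) <= cabs lambda / 2 * M * weight x.
Proof.
move=> M0 Cx fM.
have fM' y : st_size y = (st_size x).+1 -> cabs (f y) <= M * weight y.
  by move=> yx; apply: fM; rewrite yx ltnW.
apply: le_trans (transfer_le z M0 fM') _.
by rewrite !ler_wpM2r ?weight_ge0 ?tail_half.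
Qed.

(** Each use of [lambda * f x = transfer z f x] halves the bound on the tail. *)
Lemma resolvent_kernel f : inB N f -> lambda *: f - transfer z f = 0 ->
  forall x, (C < st_size x)%N -> f x = 0.
Proof.
move=> /inB_wnorm[M [M0 _ fM]] f_eigen.
have fE x : lambda * f x = transfer z f x.
  by apply/eqP; rewrite -subr_eq0 -obsZ -obsB f_eigen.
have H n x : (C < st_size x)%N -> cabs (f x) <= M * 2^-1 ^+ n * weight x.
  elim: n x => [|n IHn] x Cx; first by rewrite expr0 mulr1 fM.
  have Mn0 : 0 <= M * 2^-1 ^+ n by rewrite mulr_ge0 ?exprn_ge0 ?invr_ge0.
  rewrite -(ler_pM2l (cabs_gt0 lambda_neq0)) -cabsM fE.
  apply: le_trans (transfer_tail Mn0 Cx IHn) _; rewrite exprS; lra.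
move=> x Cx; apply: cabs_eq0.
apply: (@le_half_pow_eq0 _ _ (M * weight x)) => [|n]; first exact: cabs_ge0.
by rewrite mulrAC H.
Qed.

(** Picard iteration, started at 0, for [u = lambda^-1 * (f + T u)] on sizes above [C], with value 0
    on the other states. *)
Fixpoint approx_solution f n : obs :=
  if n is n'.+1 then fun x =>
    if (st_size x <= C)%N then 0
    else lambda^-1 * (f x + transfer z (approx_solution f n') x)
  else 0.

Lemma approx_solution_step f M n x : 0 <= M -> dominated M f ->
  cabs (approx_solution f n.+1 x - approx_solution f n x)
    <= (cabs lambda)^-1 * M * weight x * 2^-1 ^+ n.
Proof.
move=> M0 fM; have l0 := cabs_gt0 lambda_neq0.
have A0 m y : 0 <= (cabs lambda)^-1 * M * weight y * 2^-1 ^+ m.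
  apply: mulr_ge0 (mulr_ge0 (mulr_ge0 _ M0) (weight_ge0 y)) _.
    by rewrite invr_ge0 cabs_ge0.
  by rewrite exprn_ge0 ?invr_ge0.
elim: n x => [|n IHn] x.
  rewrite /= subr0; case: leqP => Cx; first by rewrite cabs0.
  have -> : transfer z (0 : obs) x = 0.
    by rewrite /transfer big1 // => r _; rewrite mulr0.
  by rewrite addr0 cabsM cabsV expr0 mulr1 -mulrA ler_wpM2l ?invr_ge0 ?cabs_ge0.
rewrite [approx_solution _ n.+2]/= [in X in _ - X]/=; case: leqP => Cx.
  by rewrite subrr cabs0.
(* The terms in [f] cancel, leaving [lambda^-1] times the transfer of the previous difference. *)
rewrite -mulrBr opprD addrACA subrr add0r cabsM cabsV.
rewrite -obsB -transferB.
have Mn0 : 0 <= (cabs lambda)^-1 * M * 2^-1 ^+ n.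
  by rewrite !mulr_ge0 ?exprn_ge0 ?invr_ge0 ?cabs_ge0.
rewrite -ler_pdivlMl ?invr_gt0 // invrK.
apply: le_trans (transfer_tail Mn0 Cx _) _ => [y _|].
  by rewrite obsB mulrAC IHn.
rewrite exprS le_eqVlt; apply/orP; left; apply/eqP; field.
by rewrite gt_eqF.
Qed.

(** The iterates converge pointwise at a geometric rate proportional to the weight, so the limit is
    in the space and the equation survives the limit. *)
Lemma resolvent_solution f : inB N f -> exists2 u : obs, inB N u &
  forall x, (C < st_size x)%N -> f x = (lambda *: u - transfer z u) x.
Proof.
move=> /inB_wnorm[M [M0 _ fM]]; have l0 := cabs_gt0 lambda_neq0.
pose A := (cabs lambda)^-1 * M; pose U := approx_solution f.
have A0 : 0 <= A by rewrite mulr_ge0 ?invr_ge0 ?cabs_ge0.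
have /choice[u uP] x : exists l, forall n,
    cabs (l - U n x) <= 2 * (A * weight x) * 2^-1 ^+ n.
  by apply: geometric_cabs_cvg => n; apply: approx_solution_step.
exists u.
  apply: (@dominated_inB (2 * A)) => x.
  (* The zeroth iterate is 0, so its distance to [u] bounds [u] itself. *)
  by have := uP x 0%N; rewrite subr0 expr0 mulr1 mulrA.
move=> x Cx; apply/esym/eqP; rewrite -subr_eq0; apply/eqP/cabs_eq0.
(* Two errors add up, from [u - U n.+1] and from the transfer of [u - U n]; each is at most
   [cabs lambda * A * weight x * 2^-1 ^+ n]. *)
apply: (@le_half_pow_eq0 _ _ (2 * cabs lambda * A * weight x)) => [|n].
  exact: cabs_ge0.
have An0 : 0 <= 2 * A * 2^-1 ^+ n.
  by apply: mulr_ge0 (mulr_ge0 _ A0) _; rewrite ?exprn_ge0 ?invr_ge0.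
have UE : lambda * U n.+1 x = f x + transfer z (U n) x.
  by rewrite /U /= leqNgt Cx /= mulVKf.
have -> : (lambda *: u - transfer z u) x - f x =
    lambda * (u x - U n.+1 x) - transfer z ((u : obs) - U n) x.
  rewrite mulrBr UE !obsE.
  by rewrite transferB obsB; ring.
apply: le_trans (cabsB _ _) _; rewrite cabsM.
have T_le : cabs (transfer z ((u : obs) - U n) x) <=
    cabs lambda / 2 * (2 * A * 2^-1 ^+ n) * weight x.
  by apply: transfer_tail => // y _; have := uP y n; rewrite obsB mulrA mulrAC.
apply: le_trans (lerD (ler_wpM2l (cabs_ge0 _) (uP x n.+1)) T_le) _.
rewrite exprS; lra.
Qed.

Lemma resolvent_fredholm :
  fredholm N (fun f : obs => lambda *: f - transfer z f).
Proof.
split.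
- pose D := cabs lambda + cabs z * (1 - kappa)^-1.
  apply: (@bounded_op_intro _ D) => [c f g|M f M0 fM].
    rewrite transfer_linear scalerDr opprD addrACA scalerBr !scalerA.
    by rewrite (mulrC lambda).
  rewrite mulrDl; apply: dominatedD (dominatedZ _ fM) (dominatedN _).
  exact: transfer_dominated.
- by apply: (@finite_dim_small C) => f [fB]; apply: resolvent_kernel.
exists #|small_state v C|, (fun i => delta (state_of_small (enum_val i))).
split=> [i|f fB]; first exact: delta_inB.
have [u uB fE] := resolvent_solution fB.
(* The residual [g] vanishes on sizes above [C], so the deltas at small states span a complement of
   the range, up to overlap. *)
exists u; pose g : obs := f - (lambda *: u - transfer z u).
have /small_sumE gE x : (C < st_size x)%N -> g x = 0.
  by move=> Cx; rewrite /g obsB fE // subrr.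
eexists; split=> //; by apply/eqP; rewrite addrC -subr_eq -/g {1}gE; apply/eqP.
Qed.

End Resolvent.

Lemma ess_spectrum_transfer z lambda :
  ess_spectrum N (@transfer R k v z) lambda -> lambda = 0.
Proof.
move=> ess; apply/eqP/negPn/negP => l0; apply: ess.
(* The denominator [cabs z + 1] also covers [z = 0]. *)
have e0 : 0 < cabs lambda / 2 / (cabs z + 1).
  by rewrite !divr_gt0 ?cabs_gt0 // ltr_wpDl ?cabs_ge0.
have [C CP] := decay_small kappa01 e0.
apply: (@resolvent_fredholm _ _ C) => // s /CP.
rewrite ler_pdivlMr ?ltr_wpDl ?cabs_ge0 //; apply: le_trans.
by rewrite mulrC ler_wpM2l ?decay_ge0 // lerDl.
Qed.

End Weighted.

(** * The decomposition, quasi-compactness and the essential spectral radius *)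

Unset Implicit Arguments.
Set Strict Implicit.

Theorem proposition4p3 (R : realType) (k : nat) (hk : (2 <= k)%N) (v : 'S_k)
    (theta kappa r0 : R)
    (theta01 : 0 < theta < 1) (kappa01 : 0 < kappa < 1) (r0_ge1 : 1 <= r0)
    (T_bounded : forall zeta : R[i], `|zeta| <= r0%:C ->
       bounded_op (@wnorm R k v theta kappa) (@transfer R k v zeta)) :
  (exists C : nat, forall zeta : R[i], `|zeta| <= 1 ->
     (opnorm (@wnorm R k v theta kappa) (@Lop R k v C zeta) < 1)%E) /\
  (forall (z : R[i]) (C : nat), `|z| <= 1 ->
     (forall zeta : R[i], `|zeta| <= 1 ->
        (opnorm (@wnorm R k v theta kappa) (@Lop R k v C zeta) < 1)%E) ->
     [/\ finite_rank (@wnorm R k v theta kappa) (@Kop R k v C z),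
         strict_contraction (@wnorm R k v theta kappa) (@Lop R k v C z),
         quasi_compact (@wnorm R k v theta kappa) (@transfer R k v z)
       & (ess_spectral_radius (@wnorm R k v theta kappa) (@transfer R k v z)
            <= opnorm (@wnorm R k v theta kappa) (@Lop R k v C z) < 1)%E]).
Proof.
have k0 : (0 < k)%N by apply: ltnW.
split.
  have [C CP] := Lop_contraction v theta01 kappa01.
  by exists C => zeta /cabs_le1; apply: CP.
move=> z C z1 L_lt1; split.
- exact: Kop_finite_rank.
- by split; [apply: Lop_bounded | apply: L_lt1].
(* The first power suffices, as [T - K = L]. *)
- exists 1%N, (@Kop R k v C z); split=> //; first exact: Kop_compact.
  suff -> : (fun f => iter 1 (@transfer R k v z) f - Kop C z f) =
      @Lop R k v C z.
    exact: L_lt1.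
  by apply/funext => f; rewrite /Kop subKr.
(* Only [lambda = 0] can lie in the essential spectrum, so nonnegativity of the operator norm gives
   the bound. *)
rewrite L_lt1 // andbT /ess_spectral_radius ge_max opnorm_ge0 //=.
apply: ge_ereal_sup => _ [lambda /ess_spectrum_transfer -> // <-].
by rewrite Normc.normc0 opnorm_ge0.
Qed.
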